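(* Let $L$ and $n$ be positive integers. The map $\rho:B\mapsto(\rho_N(B),\rho_Q(B))$ is a bijection \[\rho:\ \mathcal M(L,n)\longrightarrow\bigcup_\mu\mathrm{MLQ}_0(\mu,n)\times\mathrm{SSYT}(\mu',L),\] where the union is over partitions $\mu$, and it satisfies $x^B=x^{\rho_N(B)}$ for all $B\in\mathcal M(L,n)$.
   Context: Partitions and tableaux. $\mu'$ is the conjugate of $\mu$, $\ell(\mu)$ its length. Diagrams are in French notation (row 1 at bottom). A semistandard Young tableau (SSYT) has entries weakly increasing left to right along rows and strictly increasing up columns; $\mathrm{SSYT}(\nu,L)$ is the set of SSYT of shape $\nu$ with entries in $[L]$. Binary matrices and multiline queues. $\mathcal M(L,n)$ is the set of tuples $B=(B_1,\dots,B_L)$ of subsets of $[n]$, drawn as a grid with rows $1..L$ bottom to top, columns $1..n$ left to right, ball in $(r,j)$ iff $j\in B_r$; weight $x^B=\prod_r\prod_{b\in B_r}x_b$. For a partition $\mu$ with $n\ge\ell(\mu)$, $\mathrm{MLQ}(\mu,n)$ is the set of tuples $(B_1,\dots,B_{\mu_1})$ of subsets of $[n]$ with $|B_j|=\mu'_j$; tuples with empty top rows are identified with the tuple obtained by deleting those rows. $\mathrm{cw}(B)$ scans columns left to right, each column top to bottom, recording row numbers of balls. Major index. For $M\in\mathrm{MLQ}(\mu,n)$, $L'=\mu_1$: for $r=L',\dots,2$, unlabelled balls of row $r$ get label $r$; then the balls of row $r$ in decreasing label order (left to right among ties) are each paired with the first unlabelled ball of row $r-1$ weakly to the right, cyclically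 modulo $n$, which receives the same label; the pairing wraps if the lower ball lies strictly left of the upper ball. $\operatorname{maj}(M)=\sum(\ell(p)-r(p)+1)$ over wrapping pairings, $r(p)$ the upper row, $\ell(p)$ the label. $\mathrm{MLQ}_0(\mu,n)=\{M\in\mathrm{MLQ}(\mu,n):\operatorname{maj}(M)=0\}$. Collapsing. For a word $w$ and $i\ge1$, $\mathrm{Par}_i(w)$ writes ''('' for each $i+1$ and '')'' for each $i$ (left to right) and iteratively matches a ''('' with a '')'' to its right when adjacent or separated only by matched parentheses. $e_i^\star(B)$ moves every ball of row $i+1$ whose letter in $\mathrm{cw}(B)$ is unmatched in $\mathrm{Par}_i(\mathrm{cw}(B))$ down to row $i$ in the same column. Products act right to left; $e^\star_{[a,b]}=e^\star_ae^\star_{a+1}\cdots e^\star_b$; $\rho_N(B)=e^\star_{[1,L-1]}\cdots e^\star_{[1,2]}e^\star_{[1,1]}(B)$. With $N^{(k)}$ the bottom $k$ rows of $e^\star_{[1,k-1]}\cdots e^\star_{[1,1]}(B)$ ($1\le k\le L$) and $N^{(0)}$ empty, $\rho_Q(B)$ is the filling whose row $r$ contains $|N^{(i)}_r|-|N^{(i-1)}_r|$ entries $i$ for $i=1,\dots,L$ (with $|N^{(i-1)}_i|=0$), in weakly increasing order. *)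

(* Defs.v *)
From HB Require Import structures.
From mathcomp Require Import all_boot all_order all_algebra.
From mathcomp Require Import mpoly.
Set Implicit Arguments.
Unset Strict Implicit.
Unset Printing Implicit Defensive.
Import GRing.Theory.

(* Conventions.  A binary matrix / multiline queue with columns [1..n] is a
   [seq {set 'I_n}]; the k-th element (index k-1) is row k (rows bottom to
   top); column j of the paper is the ordinal j-1.  Row numbers are 1-based. *)

Section Defs.
Variable n : nat.
Implicit Types (B M : seq {set 'I_n}).

Definition row B (r : nat) : {set 'I_n} := nth set0 B r.-1.

Fixpoint drop_pref {T : Type} (p : pred T) (s : seq T) : seq T :=
  if s is x :: s' then (if p x then drop_pref p s' else s) else [::].
Definition trim_top {T : Type} (p : pred T) (s : seq T) : seq T :=
  rev (drop_pref p (rev s)).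

Definition is_partition (mu : seq nat) : bool :=
  sorted geq mu && all (fun m => 0 < m) mu.
Definition conj_part (mu : seq nat) : seq nat :=
  [seq count (fun m => j <= m) mu | j <- iota 1 (head 0 mu)].

(* ---------- column word: letters are (row number, column) of the balls,
   columns left to right, each column top to bottom *)
Definition cwp B : seq (nat * 'I_n) :=
  flatten [seq [seq (r, j) | r <- rev (iota 1 (size B)) & j \in row B r]
          | j <- enum 'I_n].
Definition cw B : seq nat := map fst (cwp B).

(* ---------- Par_i : bracket matching.  Letters i+1 are "(", letters i are
   ")", other letters are ignored.  The iterative matching of the paper is
   computed by the usual stack scan: a ")" matches the most recent still
   unmatched "(".  The result lists the columns of the balls of row i+1
   whose letter is unmatched. *)
Definition par_step (i : nat) (st : seq 'I_n) (p : nat * 'I_n) : seq 'I_n :=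
  if p.1 == i.+1 then p.2 :: st
  else if p.1 == i then behead st else st.
Definition unmatched_cols (i : nat) B : seq 'I_n := foldl (par_step i) [::] (cwp B).

Definition estar (i : nat) B : seq {set 'I_n} :=
  let U := [set j | j \in unmatched_cols i B] in
  mkseq (fun k => let r := k.+1 in
                  if r == i then row B r :|: U
                  else if r == i.+1 then row B r :\: U
                  else row B r) (size B).

Definition estar_int (k : nat) B : seq {set 'I_n} := foldr estar B (iota 1 k).

Definition stage (k : nat) B : seq {set 'I_n} :=
  foldl (fun C k' => estar_int k' C) B (iota 1 k.-1).

Definition rhoN B : seq {set 'I_n} := stage (size B) B.

(* |N^(i)_r| with |N^(i)_r| = 0 when r > i (and N^(0) empty) *)
Definition cntN B (i r : nat) : nat :=
  if (1 <= i) && (r <= i) then #|row (stage i B) r| else 0.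

Definition rhoQ_row B (r : nat) : seq nat :=
  flatten [seq nseq (cntN B i r - cntN B i.-1 r) i | i <- iota 1 (size B)].

Definition rhoQ B : seq (seq nat) :=
  trim_top (@nilp nat) (mkseq (fun k => rhoQ_row B k.+1) (size B)).

(* rho(B) : the multiline queue rho_N(B) (with empty top rows removed,
   as in the identification of the paper) together with rho_Q(B) *)
Definition rho B : seq {set 'I_n} * seq (seq nat) :=
  (trim_top (fun Z : {set 'I_n} => Z == set0) (rhoN B), rhoQ B).

Definition weight B : {mpoly int[n]} := \prod_(Z <- B) \prod_(b in Z) 'X_b.

Definition rowN B (r : nat) : seq nat := [seq val d | d <- enum (row B r)].

(* label of the ball in column c of the current row: the one it received
   from the pairing with the row above, or r if it is unlabelled *)
Definition full_labels (upper : seq nat) (lab : seq (nat * nat)) (r : nat)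
  : seq (nat * nat) :=
  [seq (c, head r [seq q.2 | q <- lab & q.1 == c]) | c <- upper].

Definition pairing_order (fl : seq (nat * nat)) (Lmax : nat) : seq (nat * nat) :=
  flatten [seq [seq q <- fl | q.2 == l] | l <- rev (iota 0 Lmax.+1)].

(* pair the upper ball p = (column, label) of row r with the first unlabelled
   ball of row r-1 weakly to its right, cyclically mod n; accumulate
   label - r + 1 if the pairing wraps *)
Definition pair_step (lower : seq nat) (r : nat)
    (st : seq (nat * nat) * nat) (p : nat * nat) : seq (nat * nat) * nat :=
  let: (lab, acc) := st in
  let c := p.1 in let l := p.2 in
  let cands := [seq d <- [seq (c + k) %% n | k <- iota 0 n]
               | (d \in lower) && (d \notin map fst lab)] in
  if cands is d :: _ then ((d, l) :: lab, acc + (if d < c then l - r + 1 else 0))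
  else (lab, acc).

Definition maj_step M (st : seq (nat * nat) * nat) (r : nat) : seq (nat * nat) * nat :=
  let: (lab, acc) := st in
  let fl := full_labels (rowN M r) lab r in
  foldl (pair_step (rowN M r.-1) r) ([::], acc) (pairing_order fl (size M)).

Definition maj M : nat :=
  (foldl (maj_step M) ([::], 0) (rev (iota 2 (size M).-1))).2.

Definition in_MLQ (mu : seq nat) M : bool :=
  [&& is_partition mu, size mu <= n & map (fun Z : {set 'I_n} => #|Z|) M == conj_part mu].
Definition in_MLQ0 (mu : seq nat) M : bool := in_MLQ mu M && (maj M == 0).

End Defs.

(* ---------- SSYT(nu, L), French notation, rows listed bottom to top *)
Definition is_SSYT (nu : seq nat) (L : nat) (T : seq (seq nat)) : Prop :=
  [/\ [seq size t | t <- T] = nu,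
      forall r, sorted leq (nth [::] T r),
      forall r x, x \in nth [::] T r -> 1 <= x <= L &
      forall r c, c < size (nth [::] T r.+1) ->
                  nth 0 (nth [::] T r) c < nth 0 (nth [::] T r.+1) c].

Definition in_target (n L : nat) (p : seq {set 'I_n} * seq (seq nat)) : Prop :=
  exists mu : seq nat, in_MLQ0 mu p.1 /\ is_SSYT (conj_part mu) L p.2.

(* Main.v *)
Require Import Defs.
From HB Require Import structures.
From mathcomp Require Import all_boot all_order all_algebra.
From mathcomp Require Import mpoly.
From mathcomp Require Import zify.
Set Implicit Arguments.
Unset Strict Implicit.
Unset Printing Implicit Defensive.

(**
  Everything is read off the suffix counts [suf A k] = number of balls of the
  row A in the columns >= k.  The set U of unmatched balls of an upper row A
  over a lower row C is characterised by: U is contained in A and disjoint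
  from C, suf A <= suf C + suf U, with equality at every k in U.  Hence
  suf U k is the maximum of 0 and of suf A - suf C over the columns >= k.

  Applying e*_k, ..., e*_1 to k rows, each of which dominates the next one up
  in all suffix counts, topped by an arbitrary row, yields k+1 rows with the
  same property, and the two lists of row sizes interlace.  This step is
  inverted from the bottom row up: (A, C) is recovered from (A \ U, C u U) and
  #|U|, the latter being given by the sizes.  Thus B corresponds to a
  dominating list of rows together with an interlacing chain of size lists,
  that is, with a semistandard tableau.  Finally, maj vanishes exactly on the
  dominating lists: a greedy pairing, in whatever order, never wraps under
  domination, and a pairing without wrapping is an injection moving weakly to
  the right.
*)

Lemma big_setU_disjoint (R : Type) (idx : R) (op : Monoid.com_law idx)
    (I : finType) (A B : {set I}) (F : I -> R) : [disjoint A & B] ->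
  \big[op/idx]_(i in A :|: B) F i =
    op (\big[op/idx]_(i in A) F i) (\big[op/idx]_(i in B) F i).
Proof. by move=> dAB; rewrite -bigU //; apply: eq_bigl => i; rewrite !inE. Qed.

(** * Suffix counts of the balls of a row *)

Section Insertion.
Variable n : nat.
Implicit Types (A C E U V X S : {set 'I_n}) (k : nat) (j : 'I_n).

(** The window is [[k, m)]: the upper end [m] marks how far a left-to-right scan has gone, and
    [m = n] gives suffix counts. *)
Definition win A k m := \sum_(i in A) (k <= i < m).
Definition suf A k := win A k n.

Lemma winS A k j : win A k j.+1 = win A k j + (k <= j) * (j \in A).
Proof.
rewrite /win (eq_bigr (fun i : 'I_n => (k <= i < j) + (k <= j) * (i == j))).
  rewrite big_split /= -big_distrr /=; congr (_ + _ * _).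
  rewrite -big_mkcondr /=; case: (boolP (j \in A)) => jA.
    rewrite (bigD1 j) /= ?jA ?eqxx // big1 // => i /andP[/andP[_ /eqP ->]].
    by rewrite eqxx.
  by rewrite big1 // => i /andP[iA /eqP eij]; rewrite -eij iA in jA.
by move=> i _; case: (eqVneq i j) => [->|]; rewrite -?val_eqE /=; lia.
Qed.

Lemma suf_ge A k : n <= k -> suf A k = 0.
Proof. by move=> nk; apply: big1 => i _; have := ltn_ord i; lia. Qed.

Lemma sufS A j : suf A j = (j \in A) + suf A j.+1.
Proof.
rewrite /suf /win (eq_bigr (fun i : 'I_n => (i == j) + (j < i < n))).
  rewrite big_split /=; congr (_ + _).
  rewrite -big_mkcondr /=; case: (boolP (j \in A)) => jA.
    rewrite (bigD1 j) /= ?jA ?eqxx // big1 // => i /andP[/andP[_ /eqP ->]].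
    by rewrite eqxx.
  by rewrite big1 // => i /andP[iA /eqP eij]; rewrite -eij iA in jA.
by move=> i _; have := ltn_ord i; case: (eqVneq i j) => [->|]; rewrite -?val_eqE /=; lia.
Qed.

Lemma suf0 A : suf A 0 = #|A|.
Proof.
by rewrite -sum1_card; apply: eq_bigr => i _; have := ltn_ord i; lia.
Qed.

Lemma suf_setU A U k : [disjoint A & U] -> suf (A :|: U) k = suf A k + suf U k.
Proof. exact: big_setU_disjoint. Qed.

Lemma suf_setD A U k : U \subset A -> suf (A :\: U) k + suf U k = suf A k.
Proof.
by move=> sUA; rewrite /suf /win [RHS](big_setID U) /= (setIidPr sUA) addnC.
Qed.

Lemma suf_mono A k m : k <= m -> suf A m <= suf A k.
Proof. by move=> km; apply: leq_sum => i _; lia. Qed.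

Lemma eq_suf A C : (forall k, suf A k = suf C k) -> A = C.
Proof.
move=> h; apply/setP => j; have := h j; rewrite !sufS h.
by case: (j \in A); case: (j \in C); lia.
Qed.

(** Induction from the rightmost column leftwards. The step is stated for ordinals so that [sufS]
    applies; all suffixes from [n] on are empty. *)
Lemma suf_ind (P : nat -> Prop) :
  (forall k, n <= k -> P k) -> (forall j, P j.+1 -> P j) -> forall k, P k.
Proof.
move=> Pn PS k; have [d] := ubnP (n - k); elim: d k => // d IH k kd.
case: (leqP n k) => [|kn]; first exact: Pn.
by apply: (PS (Ordinal kn)); apply: IH => /=; lia.
Qed.

Lemma pre_ind (P : nat -> Prop) :
  P 0 -> (forall k, n <= k -> P k) -> (forall j, P j -> P j.+1) -> forall k, P k.
Proof.
move=> P0 Pn PS; elim=> // k Pk; case: (leqP n k) => [nk|kn].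
  by apply: Pn; lia.
exact: (PS (Ordinal kn)).
Qed.

(** * The bracket scan of two rows and its unmatched balls *)

Definition scan_step A C (st : seq 'I_n) j :=
  let st' := if j \in A then j :: st else st in
  if j \in C then behead st' else st'.

Definition unm A C : {set 'I_n} :=
  [set j | j \in foldl (scan_step A C) [::] (enum 'I_n)].

(** While x stays on the stack, every lower ball read since x was pushed has been matched with an
    upper ball to the right of x. Hence the count is exact at stack elements and only an inequality
    elsewhere. *)
Definition scan_inv A C m (st : seq 'I_n) :=
  [/\ sorted (fun x y : 'I_n => y < x) st,
      all (fun x : 'I_n => [&& x < m, x \in A & x \notin C]) st,
      forall k, win A k m <= win C k m + count (fun x : 'I_n => k <= x) st &
      {in st, forall x : 'I_n,
         win A x m = win C x m + count (fun y : 'I_n => x <= y) st}].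

Lemma scan_invS A C j st :
  scan_inv A C j st -> scan_inv A C j.+1 (scan_step A C st j).
Proof.
have gtT : transitive (fun x y : 'I_n => y < x) by move=> x y z /= ? ?; lia.
case=> so al F1 F2; rewrite /scan_step.
have al' : all (fun x : 'I_n => [&& x < j.+1, x \in A & x \notin C]) st.
  by apply: sub_all al => x /and3P[? -> ->]; rewrite !andbT; lia.
case: (boolP (j \in A)) => jA; case: (boolP (j \in C)) => jC /=.
- split=> // [k|x xst]; rewrite !winS jA jC; first by have := F1 k; lia.
  by rewrite F2 //; lia.
- split=> /=.
  + case: st so al {F1 F2 al'} => //= x st -> /andP[/and3P[-> _ _] _] //.
  + by rewrite ltnSn jA jC.
  + by move=> k; rewrite !winS jA (negbTE jC); have := F1 k; lia.
  + move=> x; rewrite inE => /orP[/eqP->|xst]; rewrite !winS jA (negbTE jC).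
      (* Before column [j] is read, the window starting at [j] is empty and no stack element is
         [>= j], so the new ball accounts for itself alone. *)
      have w0 Y : win Y j j = 0 by apply: big1 => i _; lia.
      have c0 : count (fun y : 'I_n => j <= y) st = 0.
        apply/eqP; rewrite -leqn0 leqNgt -has_count; apply/hasPn => y yst.
        by have /and3P[] := allP al _ yst; lia.
      by rewrite !w0 c0; lia.
    by rewrite F2 //; lia.
- case: st so al F1 F2 al' => [|t st] //= so al F1 F2 al'.
    by split=> // k; rewrite !winS jC (negbTE jA); have := F1 k; move=> /=; lia.
  (* The survivors lie left of the popped column [t], so for each of them the loss of [t] from the
     stack is offset by the lower ball in [j]. *)
  have lt_t : {in st, forall x : 'I_n, x < t}.
    by apply/allP; apply: order_path_min so.
  case/andP: al' => _ al'; case/andP: al => /and3P[tj _ _] _.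
  split=> //; first exact: path_sorted so.
    by move=> k; rewrite !winS jC (negbTE jA); have := F1 k => /=; lia.
  move=> x xst; rewrite !winS jC (negbTE jA) F2 /=; last by rewrite inE xst orbT.
  by have := lt_t _ xst; lia.
- split=> // [k|x xst]; rewrite !winS (negbTE jA) (negbTE jC).
    by have := F1 k; lia.
  by rewrite F2 //; lia.
Qed.

Lemma scan_invP A C : scan_inv A C n (foldl (scan_step A C) [::] (enum 'I_n)).
Proof.
have H m : m <= n -> scan_inv A C m (foldl (scan_step A C) [::] (take m (enum 'I_n))).
  elim: m => [_|m IH mn].
    by rewrite take0; split=> // k; rewrite /win big1 // => i _; lia.
  rewrite (take_nth (Ordinal mn)) ?size_enum_ord // -cats1 foldl_cat /=.
  rewrite -[m]/(nat_of_ord (Ordinal mn)) nth_ord_enum.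
  by apply: (@scan_invS A C (Ordinal mn)); apply: IH; lia.
by have := H n (leqnn n); rewrite take_oversize // size_enum_ord.
Qed.

Definition is_unm A C U :=
  [/\ U \subset A, [disjoint C & U],
      forall k, suf A k <= suf C k + suf U k &
      {in U, forall j, suf A j = suf C j + suf U j}].

Lemma unmP A C : is_unm A C (unm A C).
Proof.
have [so al F1 F2] := scan_invP A C.
rewrite /unm; set st := foldl _ _ _ in so al F1 F2 *.
have ust : uniq st by apply: (sorted_uniq (leT := fun x y : 'I_n => y < x)) so => [x y z /= ? ? | x /=]; lia.
have sufU k : suf [set j in st] k = count (fun x : 'I_n => k <= x) st.
  rewrite /suf /win -sum1_count [RHS]big_mkcond /= (eq_bigl (mem st)) => [|i]; last by rewrite inE.
  by rewrite -big_uniq //=; apply: eq_bigr => i _; rewrite ltn_ord andbT; case: (k <= i).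
split.
- by apply/subsetP => j; rewrite inE => /(allP al)/and3P[].
- rewrite disjoint_sym disjoint_subset; apply/subsetP => j.
  by rewrite inE => /(allP al)/and3P[].
- by move=> k; rewrite sufU; apply: F1.
- by move=> j; rewrite inE => jst; rewrite sufU; apply: F2.
Qed.

(** Going right to left, suppose that j is the first column in exactly one of the sets, say U. Then
    the equality for U at j contradicts the inequality for V at j. *)
Lemma is_unm_uniq A C U V : is_unm A C U -> is_unm A C V -> U = V.
Proof.
case=> _ _ F1 F2 [_ _ G1 G2]; apply: eq_suf.
apply: suf_ind => [k nk|j IH]; first by rewrite !suf_ge.
have := F1 j; have := G1 j; have := F2 j; have := G2 j; rewrite !(sufS U) !(sufS V) IH.
by case: (j \in U); case: (j \in V) => // h1 h2; try have := h1 isT; try have := h2 isT; lia.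
Qed.

Lemma unm_eq A C U : is_unm A C U -> unm A C = U.
Proof. exact/is_unm_uniq/unmP. Qed.

(** Let P and X be the common new rows. Being unmatched then means [suf U <= suf X - suf P], with
    equality on U. Equal sizes start an induction from the left: a column j in U1 only lies in X and
    not in P, so the bound drops by one past j, below [suf U2 j.+1]. *)
Lemma unm_inj A1 C1 A2 C2 :
  A1 :\: unm A1 C1 = A2 :\: unm A2 C2 -> C1 :|: unm A1 C1 = C2 :|: unm A2 C2 ->
  #|C1| = #|C2| -> A1 = A2 /\ C1 = C2.
Proof.
have := unmP A1 C1; have := unmP A2 C2.
move: (unm A1 C1) (unm A2 C2) => U1 U2 [sU2 dU2 F2 G2] [sU1 dU1 F1 G1] eA eC cC.
have sA k : suf A1 k + suf U2 k = suf A2 k + suf U1 k.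
  by rewrite -(suf_setD k sU1) -(suf_setD k sU2) eA; lia.
have sC k : suf C1 k + suf U1 k = suf C2 k + suf U2 k.
  by rewrite -!suf_setU ?eC.
have eU : U1 = U2.
  apply: eq_suf; apply: pre_ind => [|k nk|j IH]; last 1 first.
  - move: IH (F1 j) (G1 j) (F2 j) (G2 j) (sA j) (sC j); rewrite !(sufS U1) !(sufS U2).
    case: (boolP (j \in U1)) => j1; case: (boolP (j \in U2)) => j2 IH f1 g1 f2 g2 a c; try lia.
      have jA1 := subsetP sU1 _ j1; have jC1 := disjointFl dU1 j1.
      have := F2 j.+1; have := g1 isT; move: (sA j.+1) (sC j.+1) a c.
      by rewrite !(sufS A1) !(sufS C1) !(sufS A2) !(sufS C2) jA1 jC1; lia.
    have jA2 := subsetP sU2 _ j2; have jC2 := disjointFl dU2 j2.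
    have := F1 j.+1; have := g2 isT; move: (sA j.+1) (sC j.+1) a c.
    by rewrite !(sufS A1) !(sufS C1) !(sufS A2) !(sufS C2) jA2 jC2; lia.
  - by have := sC 0; rewrite !suf0; lia.
  - by rewrite !suf_ge.
split; apply: eq_suf => k; first by have := sA k; rewrite eU; lia.
by have := sC k; rewrite eU; lia.
Qed.

(** * Domination between rows and the surplus pushed down *)

Definition domin A C := [forall j : 'I_n, suf A j <= suf C j].

Lemma dominP A C : reflect (forall k, suf A k <= suf C k) (domin A C).
Proof.
apply: (iffP forallP) => [h k|h j]; last exact: h.
case: (leqP n k) => kn; first by rewrite !suf_ge.
exact: (h (Ordinal kn)).
Qed.

Lemma domin_card A C : domin A C -> #|A| <= #|C|.
Proof. by move/dominP/(_ 0); rewrite !suf0. Qed.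

Lemma domin_trans : transitive domin.
Proof.
move=> C A E /dominP h1 /dominP h2; apply/dominP => k; exact: leq_trans (h1 k) _.
Qed.

Lemma domin0 A : domin set0 A.
Proof. by apply/dominP => k; rewrite /suf /win big_set0. Qed.

Lemma domin_sub A C : A \subset C -> domin A C.
Proof. by move=> sAC; apply/dominP => k; rewrite -(suf_setD k sAC) leq_addl. Qed.

Lemma unm_domin A C : domin (A :\: unm A C) (C :|: unm A C).
Proof.
have [sU dU F1 _] := unmP A C; apply/dominP => k; rewrite suf_setU //.
by have := suf_setD k sU; have := F1 k; lia.
Qed.

(** The first unmatched column from [k] on is a place of equality, and the bound is read off
    there. *)
Lemma unm_le A C k v :
  (forall i, k <= i -> suf A i <= suf C i + v) -> suf (unm A C) k <= v.
Proof.
have [_ _ _ F2] := unmP A C; move: k; apply: suf_ind => [k nk|j IH h].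
  by rewrite suf_ge.
case: (boolP (j \in unm A C)) => jU; first by have := F2 j jU; have := h j (leqnn _); lia.
by rewrite sufS (negbTE jU); apply: IH => i ij; apply: h; lia.
Qed.

(** The surplus shrinks on its way down: C has none over E, so whatever the enlarged row passes on
    is paid for by the balls it received. *)
Lemma unm_unm_le A C E k : domin C E ->
  suf (unm (C :|: unm A C) E) k <= suf (unm A C) k.
Proof.
move=> /dominP dCE; have [_ dU _ _] := unmP A C.
apply: unm_le => i ki; rewrite suf_setU //.
by have := dCE i; have := suf_mono (unm A C) ki; lia.
Qed.

(* Three consecutive rows: pushing the surplus of the middle row down does not
   spoil the domination just created above it. *)
Lemma unm_unm_domin A C E : domin C E ->
  domin (A :\: unm A C) ((C :|: unm A C) :\: unm (C :|: unm A C) E).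
Proof.
move=> dCE; have [sU dU F1 _] := unmP A C; have [sV _ _ _] := unmP (C :|: unm A C) E.
apply/dominP => k; have := unm_unm_le A k dCE; have := suf_setD k sV.
by rewrite suf_setU //; have := suf_setD k sU; have := F1 k; lia.
Qed.

(* The balls to lift are the u0 rightmost unmatched balls of the lower row:
   [u k] is the number of them in the columns >= k. *)
Lemma unm_surj P X u0 : domin P X -> u0 + #|P| <= #|X| ->
  exists A, exists C, exists2 U, is_unm A C U &
    [/\ A :\: U = P, C :|: U = X, #|U| = u0 &
     forall v : nat -> nat, v 0 <= u0 -> (forall k, v k.+1 <= v k) ->
      (forall k, v k + suf P k <= suf X k) -> forall k, v k <= suf U k].
Proof.
move=> /dominP dPX cPX.
pose d k := suf X k - suf P k.
(* The running minimum of [u0] and of the room [d]: the largest weakly decreasing function below [d]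
   that starts at [u0]. *)
pose u := fix u k := if k is k'.+1 then minn (u k') (d k'.+1) else u0.
have dE k : d k + suf P k = suf X k by rewrite subnK.
have u_d k : u k <= d k.
  by case: k => [|k] /=; [rewrite /d !suf0; lia | apply: geq_minr].
pose U : {set 'I_n} := [set j : 'I_n | u j.+1 < u j].
(* Since [d] falls by at most one per column, so does [u]; it falls only where [d] equals [u] and
   falls itself, that is, at a ball of X outside P. *)
have drop j : u j = (j \in U) + u j.+1 /\ (j \in U -> [/\ j \in X, j \notin P & d j = u j]).
  have := dE j; have := dE j.+1; rewrite (sufS X) (sufS P) inE /=.
  have := u_d j.
  by case: (j \in X); case: (j \in P) => /= ? ? ?; (split; [|move=> ?; split]); lia.
have un k : n <= k -> u k = 0.
  by move=> nk; have := u_d k; rewrite /d !suf_ge //; lia.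
have sufU : forall k, suf U k = u k.
  by apply: suf_ind => [k nk|j IH]; [rewrite suf_ge ?un | rewrite sufS IH; case: (drop j)].
have sUX : U \subset X by apply/subsetP => j jU; case: (drop j) => _ /(_ jU)[].
have dPU : [disjoint P & U].
  by rewrite disjoint_sym disjoint_subset; apply/subsetP=> j jU; case: (drop j) => _ /(_ jU)[].
have dXU : [disjoint X :\: U & U].
  by rewrite -setI_eq0 setDE -setIA (setIC _ U) setICr setI0.
exists (P :|: U), (X :\: U), U.
  have HX k := suf_setD k sUX; have HP k := suf_setU k dPU.
  split=> //; first exact: subsetUr.
    by move=> k; rewrite HP; have := HX k; have := dE k; have := u_d k; have := sufU k; lia.
  move=> j jU; rewrite HP; case: (drop j) => _ /(_ jU)[_ _ dj].
  by have := HX j; have := dE j; have := sufU j; lia.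
split.
- apply/setP=> j; rewrite !inE; case: (boolP (j \in P)) => [jP|_] /=; last first.
    by case: (_ < _).
  by have := disjointFr dPU jP; rewrite inE => ->.
- apply/setP=> j; rewrite !in_setU !in_setD.
  by case: (boolP (j \in U)) => [/(subsetP sUX) ->|]; rewrite ?orbF.
- by rewrite -suf0 sufU.
- move=> v v0 vm vd k; rewrite sufU; elim: k => [|k IH] //=.
  by have := vm k; have := vd k.+1; have := dE k.+1; lia.
Qed.

(* Rows are listed from top to bottom here: inserting S on top of N applies
   e*_k, ..., e*_1 successively. *)
Fixpoint ins S (N : seq {set 'I_n}) : seq {set 'I_n} :=
  if N is C :: N' then (S :\: unm S C) :: ins (C :|: unm S C) N' else [:: S].

(** * Interlacing of row sizes, and inversion of the insertion *)

Lemma size_ins S N : size (ins S N) = (size N).+1.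
Proof. by elim: N S => //= C N IH S; rewrite IH. Qed.

Lemma ins_sorted S N : sorted domin N -> sorted domin (ins S N).
Proof.
elim: N S => //= C N IH S pN.
have := IH (C :|: unm S C) (path_sorted pN).
case: N pN {IH} => [|E N] /=; first by rewrite unm_domin.
by case/andP=> dCE _ ->; rewrite unm_unm_domin.
Qed.

(** Sizes are listed from the top row down, so the chain is s0 <= t0 <= s1 <= t1 <= ... : the new
    shape exceeds the old one by a horizontal strip. *)
Fixpoint interlace (s t : seq nat) : bool :=
  if t is y :: t' then
    [&& head 0 s <= y, y <= head 0 (behead s) & interlace (behead s) t']
  else size s == 1.

Lemma size_interlace s t : interlace s t -> size s = (size t).+1.
Proof.
elim: t s => [|y t IH] [|x s] //=; [by move/eqP | |].
  by case/andP=> _ /IH.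
by case/and3P=> _ _ /IH ->.
Qed.

Notation cards := (map (fun Z : {set 'I_n} => #|Z|)).

Lemma cardsD_unm A C : #|A :\: unm A C| + #|unm A C| = #|A|.
Proof. by have [sU _ _ _] := unmP A C; rewrite -!suf0 suf_setD. Qed.

Lemma cardsU_unm A C : #|C :|: unm A C| = #|C| + #|unm A C|.
Proof. by have [_ dU _ _] := unmP A C; rewrite -!suf0 suf_setU. Qed.

(** What remains of the upper row is at most C because the unmatched balls have left. The row below
    then loses at most as many balls as it has gained, by [unm_unm_le]. *)
Lemma ins_interlace S N : sorted domin N -> interlace (cards (ins S N)) (cards N).
Proof.
elim: N S => //= C N IH S pN; have [_ _ F1 _] := unmP S C; apply/and3P; split;
  last by apply: IH; apply: path_sorted pN.
  by have := F1 0; rewrite !suf0; have := cardsD_unm S C => /=; lia.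
case: N pN {IH} => [|E N] /=; first by rewrite cardsU_unm leq_addr.
case/andP=> dCE _; have := unm_unm_le S 0 dCE; rewrite !suf0.
by have := cardsD_unm (C :|: unm S C) E; rewrite cardsU_unm => /=; lia.
Qed.

Lemma ins_inj S1 N1 S2 N2 :
  ins S1 N1 = ins S2 N2 -> cards N1 = cards N2 -> S1 = S2 /\ N1 = N2.
Proof.
elim: N1 S1 S2 N2 => [|C1 N1 IH] S1 S2 [|C2 N2] //=; first by case.
case=> eA eI [cC cN]; have [eC ->] := IH _ _ _ eI cN.
by have [-> ->] := unm_inj eA eC cC.
Qed.

(** The lower rows are lifted first, which exposes the row X that was inserted into them; X and the
    top row P0 are then split by [unm_surj]. *)
Lemma ins_surj P s : sorted domin P -> interlace (cards P) s ->
  exists S, exists N, [/\ sorted domin N, cards N = s & ins S N = P].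
Proof.
elim: P s => [|P0 P IH] [|y s] //.
- by move=> _ /size_interlace.
- by case: P {IH} => [|? ?] //= _ _; exists P0, [::].
rewrite /= => pP /and3P[Py yP il].
have [X [N [sN cN eP]]] := IH s (path_sorted pP) il.
have dPX : domin P0 X /\ #|head set0 P| <= #|X|.
  rewrite -eP; case: N {sN cN} eP => [|E N] /= eP; rewrite -eP /= in pP *.
    by case/andP: pP.
  case/andP: pP => h _; have sD : X :\: unm X E \subset X by apply: subsetDl.
  by split; [apply: domin_trans h (domin_sub sD) | apply: subset_leq_card].
have eh : head 0 (cards P) = #|head set0 P| by rewrite -eP; case: (N).
rewrite eh in yP; case: dPX => dPX cX.
(* The number of balls to lift is forced: C must keep [y] of the balls of X. *)
have [] := @unm_surj P0 X (#|X| - y) dPX; first by have := domin_card dPX => /=; move: Py cX yP => /=; lia.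
move=> A [C [U uU [eA eC cU mU]]].
have eU := unm_eq uU.
have cC : #|C| = y.
  by have := cardsU_unm A C; rewrite eU eC; move: cU cX yP => /=; lia.
exists A, (C :: N); split=> //=; last by rewrite eU eA eC eP.
  case: N sN cN eP => //= E N pN cN eP; rewrite pN andbT.
  have [sV _ F1 _] := unmP X E; have [_ dU _ _] := uU.
  rewrite -eP /= in pP yP; case/andP: pP => /dominP dP _.
  apply/dominP => k; have := suf_setU k dU; rewrite eC.
  (* Here the maximality of U is used: the surplus of X over E is a competitor, because P0 is
     dominated by what remains of X once that surplus has left. *)
  suff: suf (unm X E) k <= suf U k by have := F1 k; lia.
  apply: mU => [|i|i]; last by have := dP i; have := suf_setD i sV; lia.
    by have := cardsD_unm X E; rewrite suf0; move: yP => /=; lia.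
  exact: suf_mono.
by rewrite cN cC.
Qed.

End Insertion.

(** * Collapsing as iterated row insertion *)

Section Collapse.
Variable n : nat.
Implicit Types (A C E U V X S : {set 'I_n}) (j : 'I_n) (B N P T : seq {set 'I_n}).
Notation cards := (map (fun Z : {set 'I_n} => #|Z|)).
Notation row := Defs.row.

Lemma foldl_flatten (R I : Type) (f : R -> I -> R) z ss :
  foldl f z (flatten ss) = foldl (foldl f) z ss.
Proof. by elim: ss z => //= s ss IH z; rewrite foldl_cat IH. Qed.

Lemma foldl_map (R I J : Type) (f : R -> J -> R) (g : I -> J) z s :
  foldl f z (map g s) = foldl (fun x i => f x (g i)) z s.
Proof. by elim: s z => //= i s IH z. Qed.

Lemma eq_foldl (R I : Type) (f g : R -> I -> R) z s :
  f =2 g -> foldl f z s = foldl g z s.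
Proof. by move=> fg; elim: s z => //= i s IH z; rewrite fg IH. Qed.

(** A column is read downwards, so a ball of row i+1 is pushed before a ball of row i in the same
    column pops. The cases [m <= i] describe partly read columns and serve the induction on the
    height. *)
Lemma par_step_column B i j st m : 0 < i ->
  foldl (par_step i) st [seq (r, j) | r <- rev (iota 1 m) & j \in row B r] =
  if m < i then st else
  if m == i then (if j \in row B i then behead st else st)
  else scan_step (row B i.+1) (row B i) st j.
Proof.
move=> i0; elim: m st => [|m IH] st; first by rewrite i0.
rewrite -(addn1 m) iotaD rev_cat /= add1n addn1 /=.
have [ei|mi] := eqVneq m.+1 i.
  subst i; rewrite ltnn; case: ifP => _ /=; rewrite IH ltnSn //.
  by rewrite /par_step /= eqxx ifF //; lia.
case: (boolP (m.+1 < i)) => mi'.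
  case: ifP => _ /=; rewrite IH; last by rewrite (ltnW mi').
  by rewrite (ltnW mi') /par_step /= (negbTE mi); case: eqP => //; lia.
have [emi|mi2] := eqVneq m i.
  subst i; rewrite /scan_step; case: ifP => _ /=; rewrite IH ltnn eqxx //.
  by rewrite /par_step /= eqxx.
case: ifP => _ /=; rewrite IH (negbTE mi2); have -> : m < i = false by lia.
  by rewrite /par_step /= (negbTE mi); case: eqP => //; lia.
by [].
Qed.

Lemma unmatched_colsE B i : 0 < i < size B ->
  [set j | j \in unmatched_cols i B] = unm (row B i.+1) (row B i).
Proof.
case/andP=> i0 iB; rewrite /unm; suff -> : unmatched_cols i B =
  foldl (scan_step (row B i.+1) (row B i)) [::] (enum 'I_n) by [].
rewrite /unmatched_cols /cwp foldl_flatten foldl_map.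
apply: eq_foldl => st j; rewrite par_step_column //.
by rewrite ltnNge ltnW //= gtn_eqF.
Qed.

Lemma estar_cat P C S T : estar (size P).+1 (P ++ C :: S :: T) =
  P ++ (C :|: unm S C) :: (S :\: unm S C) :: T.
Proof.
set B := P ++ _.
have sB : size B = (size P + (size T).+2) by rewrite size_cat.
rewrite /estar unmatched_colsE ?sB; last by lia.
have -> : row B (size P).+1 = C by rewrite /row /B nth_cat ltnn subnn.
have -> : row B (size P).+2 = S by rewrite /row /B nth_cat /= ltnNge leqnSn subSnn.
apply: (@eq_from_nth _ set0); first by rewrite size_mkseq size_cat.
move=> k; rewrite size_mkseq => kB; rewrite nth_mkseq //.
rewrite nth_cat; have [kP|Pk] := ltnP k (size P).
  by rewrite !ifF /row /B ?nth_cat ?kP //; lia.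
rewrite /row /B /= nth_cat ltnNge Pk /= eqSS.
have [->|kP] := eqVneq k (size P); first by rewrite subnn.
rewrite eqSS; have [->|kP'] := eqVneq k (size P).+1; first by rewrite subSnn.
have [d ->] : exists d, k = size P + d.+2 by exists (k - (size P).+2); lia.
by rewrite addKn.
Qed.

(** The product acts right to left, so the topmost operator comes first, just as [ins] meets the
    topmost row of N first. The reversals appear because matrices are stored bottom up. *)
Lemma estar_int_ins N S T :
  estar_int (size N) (rev N ++ S :: T) = rev (ins S N) ++ T.
Proof.
elim: N S T => [|C N IH] S T //=.
rewrite /estar_int -(addn1 (size N)) iotaD foldr_cat /= add1n -/(estar_int _ _).
rewrite rev_cons cat_rcons; have := estar_cat (rev N) C S T; rewrite size_rev => ->.
by rewrite IH rev_cons cat_rcons.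
Qed.

Definition insert_rows B := foldl (fun N S => ins S N) [::] B.

Lemma insert_rows_rcons B S : insert_rows (rcons B S) = ins S (insert_rows B).
Proof. by rewrite /insert_rows -cats1 foldl_cat. Qed.

Lemma size_insert_rows B : size (insert_rows B) = size B.
Proof.
by elim/last_ind: B => // B S IH; rewrite insert_rows_rcons size_ins IH size_rcons.
Qed.

Lemma insert_rows_sorted B : sorted (@domin n) (insert_rows B).
Proof. by elim/last_ind: B => // B S IH; rewrite insert_rows_rcons ins_sorted. Qed.

Lemma stage_insert k B : 0 < k <= size B ->
  stage k B = rev (insert_rows (take k B)) ++ drop k B.
Proof.
case: k => // k; rewrite /stage /=; elim: k => [|k IH] kB.
  by case: B kB => //= S B _; rewrite take0 drop0.
rewrite -(addn1 k) iotaD foldl_cat /= IH; last by lia.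
rewrite addn1 (drop_nth set0) ?(take_nth set0 (n := k.+1)); try lia.
rewrite insert_rows_rcons -estar_int_ins size_insert_rows size_takel; last by lia.
by rewrite add1n.
Qed.

Lemma rhoN_insert B : 0 < size B -> rhoN B = rev (insert_rows B).
Proof.
move=> B0; rewrite /rhoN stage_insert; last by rewrite B0 leqnn.
by rewrite take_size drop_size cats0.
Qed.

Definition shape_at B i : seq nat := rev (cards (insert_rows (take i B))).

Lemma cntN_shape B i r : i <= size B -> 0 < r ->
  cntN B i r = nth 0 (shape_at B i) r.-1.
Proof.
case: r => // r iB _; rewrite /cntN /shape_at -map_rev /=.
have sz : size (rev (insert_rows (take i B))) = i.
  by rewrite size_rev size_insert_rows size_takel.
case: ifP => [/andP[i0 ri]|h].
  rewrite (nth_map set0) ?sz // stage_insert ?i0 //.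
  by rewrite /row nth_cat sz ri.
by rewrite nth_default // size_map sz; lia.
Qed.

Lemma weight_ins S N : weight (ins S N) = weight (S :: N).
Proof.
elim: N S => //= C N IH S; rewrite /weight !big_cons.
have := IH (C :|: unm S C); rewrite /weight => ->; rewrite big_cons !GRing.mulrA.
congr (_ * _)%R; have [sU dU _ _] := unmP S C.
rewrite [in RHS](big_setID (unm S C)) /= (setIidPr sU) big_setU_disjoint //=.
by rewrite GRing.mulrC [RHS]GRing.mulrC GRing.mulrA.
Qed.

Lemma weight_rhoN B : 0 < size B -> weight B = weight (rhoN B).
Proof.
move=> B0; rewrite rhoN_insert // [RHS](perm_big (insert_rows B)) ?perm_rev //.
elim/last_ind: B {B0} => // B S IH; rewrite insert_rows_rcons.
rewrite -[RHS]/(weight (ins S _)) weight_ins /weight big_cons -/(weight (insert_rows _)).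
by rewrite [weight _]/weight -IH -cats1 big_cat big_seq1 /= GRing.mulrC.
Qed.

(** The last insertion is undone by [ins_inj]; the row sizes it asks for are the shape one stage
    earlier. *)
Lemma insert_rows_inj B1 B2 : size B1 = size B2 -> insert_rows B1 = insert_rows B2 ->
  (forall i, i <= size B1 -> shape_at B1 i = shape_at B2 i) -> B1 = B2.
Proof.
elim/last_ind: B1 B2 => [|B1 S1 IH] B2; first by case: B2.
case/lastP: B2 => [|B2 S2]; rewrite !size_rcons // => -[sz].
rewrite !insert_rows_rcons => eI sh.
have tk i : i <= size B1 -> shape_at B1 i = shape_at B2 i.
  move=> iB; have := sh i (leqW iB).
  by rewrite /shape_at -!cats1 !takel_cat -?sz.
have [] := ins_inj eI.
  have := tk _ (leqnn _); rewrite /shape_at {2}sz !take_size.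
  exact: (can_inj revK).
by move=> -> e2; rewrite (IH B2).
Qed.

Lemma insert_rows_surj (P : seq {set 'I_n}) (sh : nat -> seq nat) :
  sorted (@domin n) P -> sh (size P) = cards P ->
  (forall i, i < size P -> interlace (sh i.+1) (sh i)) ->
  exists2 B, insert_rows B = P &
    forall i, i <= size P -> cards (insert_rows (take i B)) = sh i.
Proof.
have [m mP] := ubnP (size P); elim: m P mP => // m IH P mP sP shP il.
case: P sP shP il mP => [|Z P] sP shP il mP.
  by exists [::] => // i; rewrite leqn0 => /eqP ->.
have [S [N [sN cN eP]]] : exists S N, [/\ sorted (@domin n) N, cards N = sh (size P) & ins S N = Z :: P].
  by apply: ins_surj => //; rewrite -shP; apply: il.
have sNP : size N = size P by have := size_ins S N; rewrite eP /=; lia.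
have [||i iN|B eB shB] := IH N _ sN; rewrite ?sNP //.
  by apply: il; rewrite /=; lia.
have sB : size B = size P by rewrite -sNP -eB size_insert_rows.
exists (rcons B S); first by rewrite insert_rows_rcons eB.
move=> i iP; have [e|ne] := eqVneq i (size P).+1.
  by rewrite e -sB -(size_rcons B S) take_size insert_rows_rcons eB eP size_rcons sB shP.
have {}iP : i <= size P by move: iP => /=; lia.
by rewrite -cats1 takel_cat ?sB // shB // sNP.
Qed.

End Collapse.

Local Arguments pair_step : simpl never.
Local Arguments maj_step : simpl never.

(** * Vanishing of the major index and domination *)

Section Maj.
Variable n : nat.
Implicit Types (M : seq {set 'I_n}) (c d k l r : nat).
Implicit Types (lower upper : seq nat) (lab ps : seq (nat * nat)).
Notation cards := (map (fun Z : {set 'I_n} => #|Z|)).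
Notation row := Defs.row.

Lemma cyclic_iota c : c < n ->
  [seq (c + k) %% n | k <- iota 0 n] = iota c (n - c) ++ iota 0 c.
Proof.
move=> cn; apply: (@eq_from_nth _ 0).
  by rewrite size_map size_cat !size_iota; lia.
move=> i; rewrite size_map size_iota => i_n.
rewrite (nth_map 0) ?size_iota // nth_iota // nth_cat size_iota add0n.
case: ltnP => h; first by rewrite nth_iota // modn_small //; lia.
rewrite nth_iota; last by lia.
have -> : c + i = (c + i - n) + n by lia.
by rewrite modnDr modn_small; lia.
Qed.

Lemma filter_iota_cons (p : pred nat) a m d s :
  [seq x <- iota a m | p x] = d :: s ->
  [/\ p d, a <= d < a + m & forall x, a <= x < d -> ~~ p x].
Proof.
elim: m a => //= m IH a; case: (boolP (p a)) => pa.
  by case=> <- _; split=> // [|x]; lia.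
case/IH => pd ad h; split=> // [|x]; first by lia.
by have [->|ne] := eqVneq x a => // ax; apply: h; lia.
Qed.

Definition free lower lab := [seq d <- lower | d \notin map fst lab].

Lemma count_free (p : pred nat) lower lab d l : uniq lower -> d \in free lower lab ->
  count p (free lower lab) = p d + count p (free lower ((d, l) :: lab)).
Proof.
move=> ul df; have -> : free lower ((d, l) :: lab) = rem d (free lower lab).
  rewrite rem_filter ?filter_uniq // /free -filter_predI.
  by apply: eq_filter => x /=; rewrite inE negb_or.
by rewrite (permP (perm_to_rem df)).
Qed.

(** A wrap is recorded as strict growth of the accumulator: [l - r + 1] is positive even with
    truncated subtraction, which suffices to decide whether [maj] vanishes. *)
Variant pair_step_spec lower r lab acc c l : seq (nat * nat) * nat -> Prop :=
  | PairNone of free lower lab = [::] : pair_step_spec lower r lab acc c l (lab, acc)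
  | PairRight d of d \in free lower lab & c <= d
      & {in free lower lab, forall x, c <= x -> d <= x} :
      pair_step_spec lower r lab acc c l ((d, l) :: lab, acc)
  | PairWrap d acc' of d \in free lower lab & acc < acc'
      & {in free lower lab, forall x, x < c} :
      pair_step_spec lower r lab acc c l ((d, l) :: lab, acc').

Lemma pair_stepP lower r lab acc c l : all (fun d => d < n) lower -> c < n ->
  pair_step_spec lower r lab acc c l (pair_step n lower r (lab, acc) (c, l)).
Proof.
move=> /allP ln cn; rewrite /pair_step cyclic_iota //= filter_cat.
set p := fun d => _ && _.
have pE d : p d = (d \in free lower lab) by rewrite mem_filter andbC.
case e: (filter p (iota c (n - c))) => [|d s] /=; last first.
  have [pd cd h] := filter_iota_cons e.
  have -> : d < c = false by lia.
  rewrite addn0; apply: PairRight; rewrite -?pE //; first by lia.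
  move=> x; rewrite -pE => px cx; rewrite leqNgt; apply/negP => xd.
  by have /negP[] : ~~ p x by apply: h; rewrite cx.
have lt_c x : x \in free lower lab -> x < c.
  move=> xf; rewrite ltnNge; apply/negP => cx.
  have xn : x < n by apply: ln; move: xf; rewrite mem_filter => /andP[].
  suff: x \in [::] by []; rewrite -e mem_filter pE xf mem_iota; lia.
case e0: (filter p (iota 0 c)) => [|d s] /=.
  apply: PairNone; case ef: (free lower lab) => [//|x f].
  have xf : x \in free lower lab by rewrite ef mem_head.
  by suff: x \in [::] by []; rewrite -e0 mem_filter pE xf mem_iota /= lt_c.
have [pd /andP[_ dc] _] := filter_iota_cons e0; rewrite add0n in dc.
by rewrite dc; apply: PairWrap => //; [rewrite -pE | lia].
Qed.

Lemma pair_acc_mono lower r lab acc ps :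
  acc <= (foldl (pair_step n lower r) (lab, acc) ps).2.
Proof.
elim: ps lab acc => //= p ps IH lab acc.
case e: (pair_step _ _ _ _ p) => [lab' acc']; apply: leq_trans _ (IH _ _).
by move: e; rewrite /pair_step; case: filter => [|d s] [_ <-] //; lia.
Qed.

(** Bounded labels ensure that [pairing_order], which runs through the labels up to a maximum, omits
    no ball. *)
Lemma pair_labels_bound lower r L lab acc ps :
  all (fun q => q.2 <= L) lab -> all (fun q => q.2 <= L) ps ->
  all (fun q => q.2 <= L) (foldl (pair_step n lower r) (lab, acc) ps).1.
Proof.
elim: ps lab acc => //= p ps IH lab acc hl /andP[hp hps].
rewrite {2}/pair_step; case: filter => [|d s]; first exact: IH.
by apply: IH => //=; rewrite hp.
Qed.

(** The hypothesis is a Hall condition on suffixes and an invariant of the greedy pairing. When c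
    takes d, no free ball lies in [[c, d)], so for k between c and d the condition at k follows from
    the one at c. *)
Lemma pair_no_wrap lower r lab acc ps :
  uniq lower -> all (fun d => d < n) lower -> all (fun q => q.1 < n) ps ->
  (forall k, count (fun q => k <= q.1) ps <= count (leq k) (free lower lab)) ->
  (foldl (pair_step n lower r) (lab, acc) ps).2 = acc.
Proof.
move=> ul ln; elim: ps lab => //= -[c l] ps IH lab /andP[/= cn psn] h.
have /hasP[x xf cx] : has (leq c) (free lower lab).
  by rewrite has_count; have := h c; rewrite leqnn; lia.
case: (pair_stepP r lab acc l ln cn) => [e|d df cd mind|d acc' _ _ lt_c].
- by rewrite e in xf.
- apply: IH => // k; have := h k; rewrite (count_free _ l ul df) /=.
  have [kc|ck] := leqP k c; first by lia.
  have [kd|dk] := leqP k d; last by lia.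
  have := h c; rewrite /= leqnn (count_free _ l ul df) cd => hc _.
  have : count (leq c) (free lower ((d, l) :: lab)) = count (leq k) (free lower ((d, l) :: lab)).
    apply: eq_in_count => y; rewrite mem_filter /= inE negb_or => /andP[/andP[_ yl] yL].
    have yf : y \in free lower lab by rewrite mem_filter yl.
    by have := mind _ yf; lia.
  have : count (fun q => k <= q.1) ps <= count (fun q => c <= q.1) ps.
    by apply: sub_count => q /=; lia.
  by lia.
- by have := lt_c _ xf; lia.
Qed.

(** The accumulator never decreases, so an unchanged final value excludes every wrap, and the size
    bound excludes running out of balls. Each ball is thus paired weakly to its right,
    injectively. *)
Lemma no_wrap_pair lower r lab acc ps :
  uniq lower -> all (fun d => d < n) lower -> all (fun q => q.1 < n) ps ->
  size ps <= size (free lower lab) ->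
  (foldl (pair_step n lower r) (lab, acc) ps).2 = acc ->
  forall k, count (fun q => k <= q.1) ps <= count (leq k) (free lower lab).
Proof.
move=> ul ln; elim: ps lab => //= -[c l] ps IH lab /andP[/= cn psn] sz.
case: (pair_stepP r lab acc l ln cn) => [e|d df cd _|d acc' _ lt _].
- by rewrite e in sz.
- move=> e k; rewrite (count_free _ l ul df).
  have sz' : size ps <= size (free lower ((d, l) :: lab)).
    by have := count_free predT l ul df; rewrite !count_predT /=; lia.
  by have := IH _ psn sz' e k; lia.
- by move=> e; have := pair_acc_mono lower r ((d, l) :: lab) acc' ps; lia.
Qed.

Lemma pairing_order_perm fl L : all (fun q : nat * nat => q.2 <= L) fl ->
  perm_eq (pairing_order fl L) fl.
Proof.
move=> /allP hL; rewrite /pairing_order.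
have H s : uniq s -> perm_eq (flatten [seq [seq q <- fl | q.2 == l] | l <- s])
    [seq q <- fl | q.2 \in s].
  elim: s => [_|l s IH] /=; first by rewrite filter_pred0.
  case/andP=> ls /IH {}IH.
  rewrite perm_sym -(perm_filterC (fun q => q.2 == l)) -!filter_predI.
  rewrite perm_sym; apply: perm_cat.
    rewrite (@eq_filter _ (predI _ _) (fun q => q.2 == l)) // => q /=.
    by rewrite inE; case: eqP.
  rewrite (@eq_filter _ (predI _ _) (fun q => q.2 \in s)) // => q /=.
  by rewrite inE; case: eqP => [->|] //; rewrite (negbTE ls).
apply: (perm_trans (H _ _)); first by rewrite rev_uniq iota_uniq.
have /all_filterP-> // : all (fun q : nat * nat => q.2 \in rev (iota 0 L.+1)) fl.
by apply/allP => q /hL h; rewrite mem_rev mem_iota.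
Qed.

Lemma full_labels_bound upper lab r L : r <= L -> all (fun q => q.2 <= L) lab ->
  all (fun q => q.2 <= L) (full_labels upper lab r).
Proof.
move=> rL /allP hl; apply/allP => q /mapP[c _ ->] /=.
case e: [seq _ | _ <- _ & _] => [|l s] //=.
have /mapP[q' ] : l \in [seq q0.2 | q0 <- lab & q0.1 == c] by rewrite e mem_head.
by rewrite mem_filter => /andP[_ /hl h] ->.
Qed.

Lemma rowN_uniq M r : uniq (rowN M r).
Proof. by rewrite map_inj_uniq; [exact: enum_uniq | exact: val_inj]. Qed.

Lemma rowN_lt M r : all (fun d => d < n) (rowN M r).
Proof. by apply/allP => d /mapP[j _ ->]; apply: ltn_ord. Qed.

Lemma count_rowN M r k : count (leq k) (rowN M r) = suf (row M r) k.
Proof.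
rewrite /rowN count_map /suf /win -sum1_count big_mkcond /= -big_enum /=.
by apply: eq_bigr => j _; rewrite ltn_ord andbT; case: leqP.
Qed.

Lemma size_rowN M r : size (rowN M r) = #|row M r|.
Proof. by rewrite size_map cardE. Qed.

(** Both pairing criteria only count columns, so the order by labels enters merely as a permutation
    of the row. *)
Lemma maj_step_eq M lab acc r : r <= size M ->
  all (fun q => q.2 <= size M) lab -> #|row M r| <= #|row M r.-1| ->
  ((maj_step M (lab, acc) r).2 == acc) = domin (row M r) (row M r.-1).
Proof.
move=> rM hl cr; rewrite /maj_step.
set fl := full_labels _ _ _; set ps := pairing_order _ _.
have pps : perm_eq ps fl by apply/pairing_order_perm/full_labels_bound.
have fst_fl : map fst fl = rowN M r by rewrite -map_comp map_id_in.
have cps (p : pred nat) : count (fun q => p q.1) ps = count p (rowN M r).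
  by rewrite (permP pps) -fst_fl count_map.
have psn : all (fun q => q.1 < n) ps.
  by rewrite (perm_all _ pps); have := rowN_lt M r; rewrite -fst_fl all_map.
have fr : free (rowN M r.-1) [::] = rowN M r.-1 by apply/all_filterP/allP.
apply/eqP/dominP => [e k|h].
  rewrite -!count_rowN -cps -fr.
  apply: no_wrap_pair e k => //; [exact: rowN_uniq | exact: rowN_lt |].
  by rewrite fr (perm_size pps) -(size_map fst) fst_fl !size_rowN.
apply: pair_no_wrap => //; [exact: rowN_uniq | exact: rowN_lt |].
by move=> k; rewrite fr cps !count_rowN.
Qed.

Lemma maj_step_mono M lab acc r : acc <= (maj_step M (lab, acc) r).2.
Proof. exact: pair_acc_mono. Qed.

Lemma maj_step_bound M lab acc r : r <= size M ->
  all (fun q => q.2 <= size M) lab ->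
  all (fun q => q.2 <= size M) (maj_step M (lab, acc) r).1.
Proof.
move=> rM hl; apply: pair_labels_bound => //.
by rewrite (perm_all _ (pairing_order_perm _)); apply: full_labels_bound.
Qed.

Lemma foldl_maj_step_mono M st rs : st.2 <= (foldl (maj_step M) st rs).2.
Proof.
elim: rs st => //= r rs IH [lab acc]; apply: leq_trans _ (IH _).
exact: maj_step_mono.
Qed.

Lemma foldl_maj_step_eq M lab acc rs :
  all (fun q => q.2 <= size M) lab -> all (fun r => r <= size M) rs ->
  all (fun r => #|row M r| <= #|row M r.-1|) rs ->
  ((foldl (maj_step M) (lab, acc) rs).2 == acc) =
  all (fun r => domin (row M r) (row M r.-1)) rs.
Proof.
elim: rs lab acc => [|r rs IH] lab acc /=; first by rewrite eqxx.
move=> hl /andP[rM rsM] /andP[cr crs].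
have := maj_step_bound acc rM hl; have := maj_step_mono M lab acc r.
rewrite -(maj_step_eq acc rM hl cr).
case: (maj_step M (lab, acc) r) => lab' acc' /= le_acc hl'.
have [->|ne] := eqVneq acc' acc; first exact: IH.
by have := foldl_maj_step_mono M (lab', acc') rs; rewrite /=; lia.
Qed.

Lemma maj_eq0 M : sorted geq (cards M) ->
  (maj M == 0) = sorted (fun C A => domin A C) M.
Proof.
move=> sM; rewrite /maj foldl_maj_step_eq //; last 2 first.
- by apply/allP => r; rewrite mem_rev mem_iota; lia.
- apply/allP => -[|[|r]]; rewrite mem_rev mem_iota // => hr.
  have rM : r.+1 < size M by lia.
  move/sortedP: sM => /(_ 0 r); rewrite size_map !(nth_map set0) ?(ltnW rM) //.
  exact.
apply/allP/(sortedP set0) => [h i iM|h r].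
  by have := h i.+2; rewrite mem_rev mem_iota; apply; lia.
rewrite mem_rev mem_iota /row; case: r => [|[|r]] // hr; apply: h; lia.
Qed.

End Maj.

(** * Removal of empty top rows *)

Section Trim.
Variables (T : Type) (p : pred T).
Implicit Types s t : seq T.

Lemma drop_pref_cat s t : all p s -> drop_pref p (s ++ t) = drop_pref p t.
Proof. by elim: s => //= x s IH /andP[-> /IH]. Qed.

Lemma trim_top_cat s t : all (predC p) s -> all p t -> trim_top p (s ++ t) = s.
Proof.
move=> hs ht; rewrite /trim_top rev_cat drop_pref_cat ?all_rev //.
case/lastP: s hs => [|s x] //; rewrite all_rcons rev_rcons => /andP[/= /negbTE -> _].
by rewrite rev_cons revK.
Qed.

Lemma nth_trim_top x0 s i : (forall x, p x -> x = x0) ->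
  nth x0 (trim_top p s) i = nth x0 s i.
Proof.
move=> px; rewrite /trim_top; elim/last_ind: s => [|s x IH] //.
rewrite rev_rcons /=; case: ifP => [/px ->|_]; last by rewrite rev_cons revK.
rewrite IH nth_rcons; case: ltngtP => // [?|->]; by rewrite nth_default // ltnW.
Qed.

Lemma trim_top_inj x0 s t : (forall x, p x -> x = x0) -> size s = size t ->
  trim_top p s = trim_top p t -> s = t.
Proof.
move=> px sz e; apply: (@eq_from_nth _ x0) => // i _.
by rewrite -(nth_trim_top s i px) e nth_trim_top.
Qed.

(** Along a sorted list [p] persists once it holds, so the elements satisfying it form the top
    end. *)
Lemma trim_top_filter (r : rel T) s : transitive r -> sorted r s ->
  (forall x y, r x y -> p x -> p y) -> trim_top p s = filter (predC p) s.
Proof.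
move=> rT sr rp; suff {1}-> : s = filter (predC p) s ++ filter p s.
  by rewrite trim_top_cat ?filter_all.
elim: s sr => //= x s IH sr; have := IH (path_sorted sr).
case: (boolP (p x)) => /= px e; last by rewrite -e.
have ap : all p s by apply: sub_all (order_path_min rT sr) => y /rp; apply.
suff -> : filter (predC p) s = [::] by rewrite /= (all_filterP ap).
by apply: size0nil; apply/eqP; rewrite size_filter -leqn0 leqNgt -has_count has_predC ap.
Qed.

End Trim.

(** * Conjugation of partitions *)

Section Partitions.
Implicit Types nu mu : seq nat.

Lemma size_conj_part mu : size (conj_part mu) = head 0 mu.
Proof. by rewrite size_map size_iota. Qed.

Lemma conj_part_partition mu : is_partition (conj_part mu).
Proof.
apply/andP; split.
  apply/(sortedP 0) => i; rewrite size_conj_part => hi.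
  rewrite /conj_part !(nth_map 0) ?size_iota ?nth_iota ?(ltnW hi) //.
  by apply: sub_count => m /=; lia.
apply/allP => c /mapP[j]; rewrite mem_iota => hj ->; rewrite -has_count.
by case: mu hj => [|m mu] /=; lia.
Qed.

(** Both sides say that the cell in row i+1 and column j belongs to the diagram of [nu]. *)
Lemma ltn_count_leq nu i j : sorted geq nu -> 0 < j ->
  (i < count (leq j) nu) = (j <= nth 0 nu i).
Proof.
move=> + j0; elim: nu i => [|m nu IH] i /=; first by rewrite nth_nil; lia.
move=> pm; have snu := path_sorted pm.
have [jm|mj] := leqP j m; first by case: i => [|i] /=; rewrite ?jm // add1n ltnS IH.
have lem : all (geq m) nu by apply: order_path_min pm => a b c /=; lia.
have -> : count (leq j) nu = 0.
  apply/eqP; rewrite -leqn0 leqNgt -has_count; apply/hasPn => x /(allP lem) /=; lia.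
case: i => [|i] /=; first by lia.
have [inu|nui] := ltnP i (size nu); last by rewrite nth_default //; lia.
by have := allP lem _ (mem_nth 0 inu) => /=; lia.
Qed.

Lemma count_leq_iota a h : a <= h -> count (leq^~ a) (iota 1 h) = a.
Proof.
move=> ah; rewrite -{1}(subnKC ah) iotaD count_cat.
have -> : count (leq^~ a) (iota 1 a) = a.
  rewrite -{3}(size_iota 1 a); apply/eqP; rewrite -all_count; apply/allP => x.
  by rewrite mem_iota; lia.
rewrite -[RHS]addn0; congr (_ + _).
apply/eqP; rewrite -leqn0 leqNgt -has_count; apply/hasPn => x; rewrite mem_iota /=; lia.
Qed.

Lemma conj_partK nu : is_partition nu -> conj_part (conj_part nu) = nu.
Proof.
case/andP => sn pn; have hd : head 0 (conj_part nu) = size nu.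
  case: nu pn {sn} => [|m nu] //= /andP[m0 pn].
  rewrite /conj_part /=; case: m m0 => //= m _; congr _.+1.
  by apply/eqP; rewrite -all_count.
apply: (@eq_from_nth _ 0); rewrite size_conj_part hd // => i hi.
rewrite {1}/conj_part hd (nth_map 0) ?size_iota // nth_iota //.
rewrite {1}/conj_part count_map.
have hi' : nth 0 nu i <= head 0 nu.
  case: nu sn i hi {pn hd} => [|m nu] //= pm [|i] //= hi.
  have lem : all (geq m) nu by apply: order_path_min pm => a b c /=; lia.
  exact: (allP lem _ (mem_nth 0 hi)).
rewrite -[RHS](count_leq_iota hi'); apply: eq_in_count => j.
by rewrite mem_iota /= add1n => hj; rewrite ltn_count_leq //; lia.
Qed.

End Partitions.

(** * Sorted rows as counting functions, and interlacing by index *)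

Section Rows.
Implicit Types s t : seq nat.

(** [f i] prescribes how many entries are at most i. *)
Definition tabrow (f : nat -> nat) L : seq nat :=
  flatten [seq nseq (f i - f i.-1) i | i <- iota 1 L].

Lemma tabrowS f L : tabrow f L.+1 = tabrow f L ++ nseq (f L.+1 - f L) L.+1.
Proof. by rewrite /tabrow -[in iota 1 L.+1](addn1 L) iotaD map_cat flatten_cat /= cats0. Qed.

Lemma mem_tabrow f L x : x \in tabrow f L -> 0 < x <= L.
Proof.
elim: L => // L IH; rewrite tabrowS mem_cat mem_nseq => /orP[/IH|/andP[_ /eqP ->]]; lia.
Qed.

Lemma tabrow_sorted f L : sorted leq (tabrow f L).
Proof.
elim: L => // L IH; rewrite tabrowS sorted_pairwise; last exact: leq_trans.
rewrite pairwise_cat -!sorted_pairwise ?IH /=; try exact: leq_trans.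
apply/andP; split.
  apply/allrelP => x y /mem_tabrow hx; rewrite mem_nseq => /andP[_ /eqP ->]; lia.
by case: (f L.+1 - f L) => //= m; elim: m => //= m ->; rewrite leqnn.
Qed.

Lemma count_tabrow f L k : f 0 = 0 -> (forall i, i < L -> f i <= f i.+1) -> k <= L ->
  count (leq^~ k) (tabrow f L) = f k.
Proof.
move=> f0; elim: L k => [|L IH] k fm kL.
  by rewrite (_ : k = 0) //; lia.
have {}IH j : j <= L -> count (leq^~ j) (tabrow f L) = f j.
  by apply: IH => i iL; apply: fm; lia.
rewrite tabrowS count_cat count_nseq; have [e|ne] := eqVneq k L.+1; last first.
  rewrite IH; last by lia.
  have -> : (L < k) = false by lia.
  by rewrite mul0n addn0.
rewrite e leqnn mul1n -[in count _ _]addn1.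
have -> : count (leq^~ (L + 1)) (tabrow f L) = count (leq^~ L) (tabrow f L).
  by apply: eq_in_count => x /mem_tabrow; lia.
by rewrite IH //; have := fm L (leqnn _); lia.
Qed.

Lemma size_tabrow f L : f 0 = 0 -> (forall i, i < L -> f i <= f i.+1) ->
  size (tabrow f L) = f L.
Proof.
move=> f0 fm; rewrite -[RHS](count_tabrow f0 fm (leqnn L)).
by apply/esym/eqP; rewrite -all_count; apply/allP => x /mem_tabrow; lia.
Qed.

Lemma eq_sorted_count L s t : sorted leq s -> sorted leq t ->
  all (leq^~ L) s -> all (leq^~ L) t ->
  (forall k, k <= L -> count (leq^~ k) s = count (leq^~ k) t) -> s = t.
Proof.
move=> ss st ls lt h.
have {}h k : count (leq^~ k) s = count (leq^~ k) t.
  have [kL|Lk] := leqP k L; first exact: h.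
  have big u : all (leq^~ L) u -> count (leq^~ k) u = count (leq^~ L) u.
    by move=> lu; apply: eq_in_count => x /(allP lu); lia.
  by rewrite !big ?h.
apply: (sorted_eq leq_trans anti_leq) => //; apply/allP => x _; apply/eqP => /=.
have split u : count (leq^~ x) u = count_mem x u + (if x is y.+1 then count (leq^~ y) u else 0).
  elim: u => [|a u IH] /=; first by case: (x).
  by case: (x) IH => [|y] /= IH; lia.
have := h x; rewrite !split; case: x {split} => [|y]; first by rewrite !addn0.
by rewrite h => /addIn.
Qed.

(** The entries at most y form a prefix of a sorted row. This turns conditions on the entries of a
    tableau into conditions on counts. *)
Lemma nth_sorted_leq t c y : sorted leq t -> c < size t ->
  (nth 0 t c <= y) = (c < count (leq^~ y) t).
Proof.
elim: t c => //= a t IH c pa hc; have st := path_sorted pa.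
have la : all (leq a) t by apply: order_path_min pa; apply: leq_trans.
have [ay|ya] := leqP a y; first by case: c hc => [|c] hc /=; rewrite ?ay // add1n ltnS IH.
have -> : count (leq^~ y) t = 0.
  apply/eqP; rewrite -leqn0 leqNgt -has_count; apply/hasPn => x /(allP la) /=; lia.
case: c hc => [|c] hc /=; first by lia.
have : a <= nth 0 t c by apply: (allP la); apply: mem_nth.
lia.
Qed.

Lemma interlace_nthP s t : interlace s t <-> size s = (size t).+1 /\
  forall i, i < size t -> nth 0 s i <= nth 0 t i <= nth 0 s i.+1.
Proof.
elim: t s => [|y t IH] s /=.
  by split=> [/eqP ->|[-> _]].
case: s => [|x s] /=.
  by split=> [/andP[_ /IH[]] //|[]].
rewrite -nth0; split=> [/and3P[xy ys /IH[-> h]]|[[sz] h]].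
  by split=> // -[|i] hi /=; [rewrite xy | apply: h].
have /andP[-> ->] := h 0 (ltn0Sn _); apply/IH; split=> // i hi.
exact: (h i.+1).
Qed.

(** Bottom-up form, the usual horizontal strip condition. The index can be unbounded because the
    default value 0 stands for absent rows. *)
Lemma interlace_rev_nthP s t : interlace (rev s) (rev t) <-> size s = (size t).+1 /\
  forall r, (nth 0 t r <= nth 0 s r) && (nth 0 s r.+1 <= nth 0 t r).
Proof.
rewrite interlace_nthP !size_rev; split=> -[sz h]; split=> // r.
  have [rt|tr] := ltnP r (size t); last first.
    by rewrite (nth_default 0 tr) (nth_default 0 (n := r.+1)) ?sz.
  have := h (size t - r.+1); rewrite !nth_rev ?sz; try lia.
  have -> : size t - (size t - r.+1).+1 = r by lia.
  have -> : (size t).+1 - (size t - r.+1).+1 = r.+1 by lia.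
  have -> : (size t).+1 - (size t - r.+1).+2 = r by lia.
  by move=> hh; have := hh _; lia.
move=> rt; have := h (size t - r.+1); rewrite !nth_rev ?sz; try lia.
have -> : (size t).+1 - r.+1 = (size t - r.+1).+1 by lia.
have -> : (size t).+1 - r.+2 = size t - r.+1 by lia.
by lia.
Qed.

End Rows.

(** * The map [rho] and its inverse *)

Section Rho.
Variable n : nat.
Implicit Types (B M P : seq {set 'I_n}) (Q : seq (seq nat)) (i k r : nat).
Notation cards := (map (fun Z : {set 'I_n} => #|Z|)).

Lemma size_rhoN B : 0 < size B -> size (rhoN B) = size B.
Proof. by move=> B0; rewrite rhoN_insert // size_rev size_insert_rows. Qed.

Lemma size_shape_at B i : i <= size B -> size (shape_at B i) = i.
Proof. by move=> iB; rewrite size_rev size_map size_insert_rows size_takel. Qed.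

Lemma shape_at_interlace B i r : i < size B ->
  (nth 0 (shape_at B i) r <= nth 0 (shape_at B i.+1) r) &&
  (nth 0 (shape_at B i.+1) r.+1 <= nth 0 (shape_at B i) r).
Proof.
move=> iB; suff /interlace_rev_nthP[_] : interlace (rev (shape_at B i.+1)) (rev (shape_at B i)) by apply.
rewrite !revK (take_nth set0) // insert_rows_rcons.
exact/ins_interlace/insert_rows_sorted.
Qed.

Lemma rhoQ_rowE B r : rhoQ_row B r = tabrow (cntN B ^~ r) (size B).
Proof. by []. Qed.

Lemma cntN_mono B r i : i < size B -> cntN B i r.+1 <= cntN B i.+1 r.+1.
Proof.
by move=> iB; rewrite !cntN_shape //; [case/andP: (shape_at_interlace r iB) | apply: ltnW].
Qed.

Lemma cntN_strip B r i : i < size B -> cntN B i.+1 r.+2 <= cntN B i r.+1.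
Proof.
by move=> iB; rewrite !cntN_shape //; [case/andP: (shape_at_interlace r iB) | apply: ltnW].
Qed.

Lemma count_rhoQ_row B r k : k <= size B ->
  count (leq^~ k) (rhoQ_row B r.+1) = cntN B k r.+1.
Proof.
by move=> kB; rewrite rhoQ_rowE count_tabrow // => i iB; apply: cntN_mono.
Qed.

Lemma size_rhoQ_row B r : 0 < size B ->
  size (rhoQ_row B r.+1) = nth 0 (cards (rhoN B)) r.
Proof.
move=> B0; rewrite rhoQ_rowE size_tabrow //; last by move=> i; apply: cntN_mono.
by rewrite cntN_shape // /shape_at take_size -map_rev -rhoN_insert.
Qed.

Lemma nth_rhoQ B r : nth [::] (rhoQ B) r = if r < size B then rhoQ_row B r.+1 else [::].
Proof.
rewrite /rhoQ nth_trim_top; last by move=> x /nilP.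
by case: ltnP => h; [rewrite nth_mkseq | rewrite nth_default ?size_mkseq].
Qed.

(** The known number of rows undoes the trimming, and counting the entries at most i in the tableau
    returns the shape at stage i. *)
Lemma rho_inj B1 B2 : 0 < size B1 -> size B1 = size B2 -> rho B1 = rho B2 -> B1 = B2.
Proof.
move=> B0 sz [eN eQ]; have B0' : 0 < size B2 by rewrite -sz.
have eI : insert_rows B1 = insert_rows B2.
  apply: (can_inj revK); rewrite -!rhoN_insert //.
  by apply: (trim_top_inj (x0 := set0)) eN => [Z /eqP//|]; rewrite !size_rhoN.
apply: insert_rows_inj => // i iB.
have iB' : i <= size B2 by rewrite -sz.
apply: (@eq_from_nth _ 0); first by rewrite !size_shape_at.
move=> r; rewrite size_shape_at // => ri.
rewrite -[r]/(r.+1.-1) -!cntN_shape // -!count_rhoQ_row //.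
have := congr1 (fun Q => nth [::] Q r) eQ; rewrite /= !nth_rhoQ -sz.
by rewrite (leq_trans ri iB) => ->.
Qed.

Lemma rhoN_sorted B : 0 < size B -> sorted (fun C A => domin A C) (rhoN B).
Proof. by move=> B0; rewrite rhoN_insert // rev_sorted; apply: insert_rows_sorted. Qed.

Lemma flip_domin_trans : transitive (fun C A : {set 'I_n} => domin A C).
Proof. by move=> C A E /= h1 h2; apply: domin_trans h2 h1. Qed.

Lemma sorted_cards M : sorted (fun C A => domin A C) M -> sorted geq (cards M).
Proof. by rewrite sorted_map; apply: sub_sorted => C A /= /domin_card. Qed.

Lemma trim_rhoN B : 0 < size B ->
  trim_top (fun Z : {set 'I_n} => Z == set0) (rhoN B) =
  [seq Z <- rhoN B | Z != set0].
Proof.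
move=> B0; apply: (trim_top_filter flip_domin_trans (rhoN_sorted B0)).
by move=> C A /domin_card + /eqP C0; rewrite C0 cards0 leqn0 cards_eq0.
Qed.

Lemma cards_trim_rhoN B : 0 < size B ->
  cards [seq Z <- rhoN B | Z != set0] = [seq m <- cards (rhoN B) | 0 < m].
Proof.
by move=> B0; rewrite filter_map; congr map; apply: eq_filter => Z /=; rewrite card_gt0.
Qed.

Lemma size_rhoQ B : 0 < size B ->
  map size (rhoQ B) = [seq m <- cards (rhoN B) | 0 < m].
Proof.
move=> B0.
have szE : map size (mkseq (fun k => rhoQ_row B k.+1) (size B)) = cards (rhoN B).
  apply: (@eq_from_nth _ 0); first by rewrite !size_map size_iota size_rhoN.
  move=> r; rewrite !size_map size_iota => rB.
  by rewrite (nth_map [::]) ?size_mkseq // nth_mkseq // size_rhoQ_row.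
rewrite /rhoQ (trim_top_filter (r := fun s t : seq nat => size t <= size s)).
- by rewrite -szE filter_map; congr map; apply: eq_filter => -[].
- by move=> s t u /= h1 h2; apply: leq_trans h2 h1.
- by have := sorted_cards (rhoN_sorted B0); rewrite -szE sorted_map.
- by move=> s t le_ts /nilP es; move: le_ts; rewrite es; case: t.
Qed.

Lemma rho_in_target B : 0 < size B -> in_target (size B) (rho B).
Proof.
move=> B0; rewrite /rho trim_rhoN //.
set M := filter _ _; set nu := cards M.
have nuE : nu = [seq m <- cards (rhoN B) | 0 < m] by rewrite /nu cards_trim_rhoN.
have sM : sorted (fun C A => domin A C) M.
  by apply: sorted_filter (rhoN_sorted B0); apply: flip_domin_trans.
have nuP : is_partition nu by rewrite /is_partition sorted_cards //= nuE filter_all.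
exists (conj_part nu); split.
  apply/andP; split; last by rewrite maj_eq0 // sorted_cards.
  (* The length of [mu] is the size of the bottom row, a set of columns, hence at most [n]. *)
  rewrite /in_MLQ conj_part_partition conj_partK // eqxx andbT /= size_conj_part /nu.
  by case: M {nu nuE sM nuP} => //= Z M; rewrite -[n in _ <= n]card_ord max_card.
split.
- by rewrite /= conj_partK // size_rhoQ.
- by move=> r; rewrite /= nth_rhoQ; case: ifP => // _; apply: tabrow_sorted.
- by move=> r x; rewrite /= nth_rhoQ; case: ifP => // _; apply: mem_tabrow.
move=> r c; rewrite /= !nth_rhoQ; case: (ltnP r.+1 (size B)) => //= rB hc.
have sr k : sorted leq (rhoQ_row B k) by apply: tabrow_sorted.
(* More than c entries of this row are at most x; by the strip condition more than c entries of the
   row below are at most x - 1, so the entry below is smaller than x. *)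
rewrite (ltnW rB); set x := nth 0 (rhoQ_row B r.+2) c.
have : 0 < x <= size B by apply: mem_tabrow (mem_nth 0 hc).
have : c < count (leq^~ x) (rhoQ_row B r.+2) by rewrite -nth_sorted_leq // leqnn.
case: x => // y cy /= yB; rewrite ltnS.
have cy' : c < count (leq^~ y) (rhoQ_row B r.+1).
  rewrite count_rhoQ_row // in cy; rewrite count_rhoQ_row ?(ltnW yB) //.
  exact: leq_trans cy (cntN_strip _ _).
by rewrite nth_sorted_leq // (leq_trans cy' (count_size _ _)).
Qed.

(** Below the last entry that is at most i+1 there stands an entry that is at most i. *)
Lemma SSYT_strip nu L Q i r : sorted geq nu -> is_SSYT nu L Q ->
  count (leq^~ i.+1) (nth [::] Q r.+1) <= count (leq^~ i) (nth [::] Q r).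
Proof.
move=> snu [szQ sQ _ colQ].
set m := count _ (nth _ _ r.+1); case em: m => [//|c].
have cm : c < count (leq^~ i.+1) (nth [::] Q r.+1) by rewrite -/m em.
have hc : c < size (nth [::] Q r.+1) by apply: leq_trans cm (count_size _ _).
have rQ : r.+1 < size Q by rewrite ltnNge; apply/negP => h; rewrite (nth_default _ h) in hc.
have hc' : c < size (nth [::] Q r).
  apply: leq_trans hc _; rewrite -!(nth_map [::] 0 size) ?szQ ?(ltnW rQ) //.
  by apply: (sortedP 0 snu); rewrite -szQ size_map.
by rewrite -nth_sorted_leq // -ltnS; apply: leq_trans (colQ _ _ hc) _; rewrite nth_sorted_leq.
Qed.

Lemma SSYT_count0 nu L Q i r : sorted geq nu -> is_SSYT nu L Q -> i <= r ->
  count (leq^~ i) (nth [::] Q r) = 0.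
Proof.
move=> snu hQ; have [_ _ eQ _] := hQ; elim: i r => [|i IH] [|r] ir //; last first.
  by apply/eqP; rewrite -leqn0 -(IH r) //; apply: SSYT_strip snu hQ.
all: by apply/eqP; rewrite -leqn0 leqNgt -has_count; apply/hasPn => x /eQ; lia.
Qed.

Lemma SSYT_count_all nu L Q r : is_SSYT nu L Q ->
  count (leq^~ L) (nth [::] Q r) = size (nth [::] Q r).
Proof.
by case=> _ _ eQ _; apply/eqP; rewrite -all_count; apply/allP => x /eQ /andP[].
Qed.

Lemma rho_surj L (p : seq {set 'I_n} * seq (seq nat)) : 0 < L -> in_target L p ->
  exists2 B : seq {set 'I_n}, size B = L & rho B = p.
Proof.
case: p => M Q L0 [mu []] /=; set nu := conj_part mu.
case/andP=> /and3P[_ _ /eqP cM] majM hQ; rewrite -/nu in cM.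
have /andP[snu pnu] : is_partition nu by apply: conj_part_partition.
have [szQ sQ eQ _] := hQ.
have sM : sorted (fun C A => domin A C) M by rewrite -maj_eq0 // cM.
have sMQ : size M = size Q by rewrite -(size_map (fun Z : {set 'I_n} => #|Z|)) cM -szQ size_map.
have szr r : size (nth [::] Q r) = nth 0 nu r.
  have [rQ|Qr] := ltnP r (size Q); first by rewrite -szQ (nth_map [::]).
  by rewrite !nth_default // -szQ size_map.
(* With more than L rows, row L+1 would be nonempty, yet by column strictness all its entries would
   exceed L. *)
have MnE : size M <= L.
  rewrite leqNgt; apply/negP => LM.
  have := SSYT_count_all L hQ; rewrite (SSYT_count0 snu hQ) // szr => /esym e0.
  have : 0 < nth 0 nu L by apply: (allP pnu); apply: mem_nth; rewrite -cM size_map.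
  by rewrite e0.
pose N := M ++ nseq (L - size M) set0.
have sN : size N = L by rewrite size_cat size_nseq subnKC.
have nthN r : #|nth set0 N r| = nth 0 nu r.
  rewrite nth_cat -cM nth_nseq; have [rM|Mr] := ltnP r (size M).
    by rewrite (nth_map set0).
  by rewrite if_same cards0 nth_default // size_map.
have dN : sorted (@domin n) (rev N).
  rewrite rev_sorted; case: M @N sM {majM cM sMQ MnE sN nthN} => [|Z M] /= sM.
    by elim: (L - 0) => //= m; case: m => //= m ->; rewrite domin0.
  rewrite cat_path sM /=; elim: (L - _) (last Z M) => //= m IH A.
  by rewrite domin0 IH.
(* The shape of the entries at most i, listed top down. Cutting it at i rows loses nothing by
   [SSYT_count0] and gives it the length of stage i. *)
pose sh i := rev (mkseq (fun r => count (leq^~ i) (nth [::] Q r)) i).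
have nth_sh i r : nth 0 (rev (sh i)) r = count (leq^~ i) (nth [::] Q r).
  rewrite revK; have [ri|ir] := ltnP r i; first by rewrite nth_mkseq.
  by rewrite nth_default ?size_mkseq // (SSYT_count0 snu hQ).
have [|i iL|B eB shB] := @insert_rows_surj n (rev N) sh dN.
- rewrite size_rev sN map_rev; congr rev; apply: (@eq_from_nth _ 0).
    by rewrite size_mkseq size_map sN.
  move=> r; rewrite size_mkseq => rL.
  by rewrite nth_mkseq // (nth_map set0) ?sN // nthN (SSYT_count_all _ hQ) szr.
- rewrite size_rev sN in iL; rewrite -(revK (sh i.+1)) -(revK (sh i)); apply/interlace_rev_nthP; split.
    by rewrite !size_rev !size_mkseq.
  move=> r; rewrite !nth_sh (SSYT_strip _ _ snu hQ) andbT.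
  by apply: sub_count => x /=; lia.
rewrite size_rev sN in shB; have sB : size B = L by rewrite -size_insert_rows eB size_rev sN.
have B0 : 0 < size B by rewrite sB.
exists B => //; rewrite /rho rhoN_insert // eB revK; congr (_, _).
  rewrite trim_top_cat //; last by rewrite all_nseq eqxx orbT.
  by apply/allP => Z ZM; rewrite /= -card_gt0; apply: (allP pnu); rewrite -cM; apply: map_f.
have rowE r : rhoQ_row B r.+1 = nth [::] Q r.
  apply: (@eq_sorted_count L); [exact: tabrow_sorted | exact: sQ | | |].
  - by apply/allP => x /mem_tabrow; rewrite sB => /andP[].
  - by apply/allP => x /eQ /andP[].
  move=> k kL; rewrite count_rhoQ_row ?sB // cntN_shape ?sB //= /shape_at.
  by rewrite shB // -nth_sh.
have -> : rhoQ B = trim_top (@nilp nat) (Q ++ nseq (L - size Q) [::]).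
  congr trim_top; apply: (@eq_from_nth _ [::]).
    by rewrite size_mkseq size_cat size_nseq sB subnKC // -sMQ.
  move=> r; rewrite size_mkseq => rB; rewrite nth_mkseq // rowE nth_cat nth_nseq.
  by case: ltnP => // h; rewrite if_same nth_default.
rewrite trim_top_cat //; last by rewrite all_nseq orbT.
apply/allP => t tQ; rewrite /= /nilp -lt0n; apply: (allP pnu).
by rewrite -szQ; apply: map_f.
Qed.

End Rho.

Theorem theorem4p19 (L n : nat) : 0 < L -> 0 < n ->
  [/\ (forall B1 B2 : seq {set 'I_n}, size B1 = L -> size B2 = L ->
          rho B1 = rho B2 -> B1 = B2),
      (forall B : seq {set 'I_n}, size B = L -> in_target L (rho B)),
      (forall p : seq {set 'I_n} * seq (seq nat), in_target L p ->
          exists2 B : seq {set 'I_n}, size B = L & rho B = p) &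
      (forall B : seq {set 'I_n}, size B = L -> weight B = weight (rhoN B))].
Proof.
move=> L0 _; split.
- by move=> B1 B2 s1 s2; apply: rho_inj; rewrite ?s1 ?s2.
- by move=> B sB; rewrite -sB; apply: rho_in_target; rewrite sB.
- by move=> p; apply: rho_surj.
- by move=> B sB; apply: weight_rhoN; rewrite sB.
Qed.
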